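(* Let $D$ be a real $m\times p$ matrix with rows $d_1^t,\dots,d_m^t$, and let the constraint set be the sparsity set $S_k\subseteq\mathbb{R}^m$ of vectors with at most $k$ nonzero components. Suppose that $\rho$ is sufficiently large and that the loss $f:\mathbb{R}^p\to\mathbb{R}$ is semialgebraic, strongly convex, and possesses a Lipschitz gradient. Then the proximal distance iterates $$x_{n+1}=\operatorname{argmin}_{x\in\mathbb{R}^p}\Big[f(x)+\frac{\rho}{2}\|Dx-\mathcal{P}(Dx_n)\|^2\Big]$$ converge linearly to a stationary point $x_\infty$ of $h_\rho(x)=f(x)+\frac{\rho}{2}\operatorname{dist}(Dx,S_k)^2$, provided $Dx_\infty$ has $k$ unambiguous largest components in magnitude. When the rows of $D$ are unique (that is, $d_i\neq d_j$ for all $i\neq j$), the complementary set of points $x\in\mathbb{R}^p$ where $Dx$ has $k$ ambiguous largest components in magnitude has Lebesgue measure $0$.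
   Context: Here $x_\infty$ is the limit of the iterates $x_n$. $\operatorname{dist}(z,S_k)=\min_{s\in S_k}\|z-s\|$, and $\mathcal{P}(z)$ is a chosen point of $S_k$ closest to $z$ (the projection may be multivalued; any representative may be chosen), obtained by keeping $k$ components of $z$ of largest magnitude and setting the others to $0$. A vector $y\in\mathbb{R}^m$ has $k$ unambiguous largest components in magnitude if there is an index set $I$ with $|I|=k$ and $|y_i|>|y_j|$ for all $i\in I$, $j\notin I$; otherwise its $k$ largest components in magnitude are ambiguous. Linear convergence means that there are constants $C>0$ and $q\in(0,1)$ with $\|x_n-x_\infty\|\le Cq^n$ for all $n$. A stationary point $x$ of $h_\rho$ satisfies $0=\nabla f(x)+\rho D^t(Dx-z)$ for all $z\in S_k$ with $\|Dx-z\|=\operatorname{dist}(Dx,S_k)$. Semialgebraic sets are the members of the smallest class of subsets of Euclidean spaces containing all sets $\{x:q(x)>0\}$ with $q$ a polynomial and closed under finite unions, finite intersections, complements, and Cartesian products; a function is semialgebraic if its graph is a semialgebraic set.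
   Formalization: In the measure-zero claim the rows are also assumed to satisfy d_i ≠ −d_j for i ≠ j; with only d_i ≠ d_j it fails, e.g. for D = (1,−1)^t and k = 1, where Dx = (x,−x) is ambiguous for every x. *)

(* Defs.v *)
(* MathComp-Analysis; vectors are columns ['cV[R]_n]. *)
From HB Require Import structures.
From mathcomp Require Import all_boot all_order all_algebra.
From mathcomp Require mpoly.
From mathcomp Require Import all_classical all_reals all_analysis.
Import Order.TTheory GRing.Theory Num.Theory.
Import numFieldNormedType.Exports.

Set Implicit Arguments.
Unset Strict Implicit.
Unset Printing Implicit Defensive.

Local Open Scope classical_set_scope.
Local Open Scope ring_scope.

(* The norm [`|x|] that the library puts on matrices is the max norm, which
   induces the same topology but not the same distances and projections. *)
Definition enorm (R : realType) (n : nat) (x : 'cV[R]_n) : R :=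
  Num.sqrt (\sum_(i < n) x i 0 ^+ 2).

Definition dist (R : realType) (n : nat) (y : 'cV[R]_n) (S : set 'cV[R]_n) : R :=
  inf [set enorm (y - s) | s in S].

Definition sparse (R : realType) (m k : nat) : set 'cV[R]_m :=
  [set s : 'cV[R]_m | (#|[pred i | (s i 0 != 0)%R]| <= k)%N].
Arguments sparse R m k : clear implicits.

Definition closest (R : realType) (n : nat) (S : set 'cV[R]_n)
    (y s : 'cV[R]_n) : Prop :=
  S s /\ enorm (y - s) = dist y S.

(* For [k <= m], the closest points of [sparse R m k] to [y] are exactly the
   vectors obtained by keeping [k] components of [y] of largest magnitude and
   zeroing the others. *)
Definition projection (R : realType) (n : nat) (S : set 'cV[R]_n)
    (P : 'cV[R]_n -> 'cV[R]_n) : Prop :=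
  forall y, closest S y (P y).

Definition unambiguous (R : realType) (m k : nat) (y : 'cV[R]_m) : Prop :=
  exists I : {set 'I_m}, #|I| = k /\
    (forall i j, i \in I -> j \notin I -> `|y j 0| < `|y i 0|).

Inductive semialgebraic (R : realType) : forall n : nat, set 'cV[R]_n -> Prop :=
| semialgebraic_pos n (q : mpoly.mpoly n R) :
    semialgebraic [set x : 'cV[R]_n | 0 < mpoly.meval (fun i => x i 0) q]
| semialgebraic_union n (A B : set 'cV[R]_n) :
    semialgebraic A -> semialgebraic B -> semialgebraic (A `|` B)
| semialgebraic_inter n (A B : set 'cV[R]_n) :
    semialgebraic A -> semialgebraic B -> semialgebraic (A `&` B)
| semialgebraic_compl n (A : set 'cV[R]_n) :
    semialgebraic A -> semialgebraic (~` A)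
| semialgebraic_prod n1 n2 (A : set 'cV[R]_n1) (B : set 'cV[R]_n2) :
    semialgebraic A -> semialgebraic B ->
    semialgebraic [set x : 'cV[R]_(n1 + n2) | A (usubmx x) /\ B (dsubmx x)].

Definition semialgebraic_fun (R : realType) (p : nat) (f : 'cV[R]_p -> R) : Prop :=
  semialgebraic [set col_mx x ((f x)%:M : 'cV[R]_1) | x in [set: 'cV[R]_p]].

Definition strongly_convex (R : realType) (p : nat) (f : 'cV[R]_p -> R) : Prop :=
  exists2 mu : R, 0 < mu & forall (x y : 'cV[R]_p) (t : R), 0 <= t <= 1 ->
    f (t *: x + (1 - t) *: y) <=
      t * f x + (1 - t) * f y - mu / 2 * t * (1 - t) * enorm (x - y) ^+ 2.

Definition gradient (R : realType) (p : nat) (f : 'cV[R]_p -> R)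
    (x : 'cV[R]_p) : 'cV[R]_p :=
  \col_i 'D_(delta_mx i 0) f x.

Definition lipschitz_gradient (R : realType) (p : nat) (f : 'cV[R]_p -> R) : Prop :=
  (forall x, differentiable f x) /\
  exists L : R, forall x y,
    enorm (gradient f x - gradient f y) <= L * enorm (x - y).

Definition argmin (R : realType) (T : Type) (g : T -> R) (x : T) : Prop :=
  forall y, g x <= g y.

Definition proximal_distance_iterates (R : realType) (m p : nat)
    (D : 'M[R]_(m, p)) (f : 'cV[R]_p -> R) (rho : R)
    (P : 'cV[R]_m -> 'cV[R]_m) (x : nat -> 'cV[R]_p) : Prop :=
  forall n, argmin
    (fun y => f y + rho / 2 * enorm (D *m y - P (D *m x n)) ^+ 2) (x n.+1).

(* Stationary points of [fun x => f x + rho / 2 * dist (D *m x) S ^+ 2], a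
   function which need not be differentiable: the equation is required for
   every closest point. *)
Definition stationary (R : realType) (m p : nat) (D : 'M[R]_(m, p))
    (S : set 'cV[R]_m) (f : 'cV[R]_p -> R) (rho : R) (x : 'cV[R]_p) : Prop :=
  forall z, closest S (D *m x) z ->
    gradient f x + rho *: (D^T *m (D *m x - z)) = 0.

Definition linear_convergence (R : realType) (p : nat)
    (x : nat -> 'cV[R]_p) (l : 'cV[R]_p) : Prop :=
  exists C q : R, [/\ 0 < C, 0 < q < 1 &
    forall n, enorm (x n - l) <= C * q ^+ n].

(* The library has Lebesgue measure on [R] only.  On [R^p] this is the outer
   measure; a set has Lebesgue measure 0 iff its outer measure is 0.  Families
   are indexed by subsets [J] of [nat] so that the empty family is allowed: in
   dimension 0 a box cannot have volume 0. *)
Definition lebesgue_outer (R : realType) (p : nat) (A : set 'cV[R]_p) : \bar R :=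
  ereal_inf [set v : \bar R |
    exists (J : set nat) (a b : nat -> 'cV[R]_p),
      [/\ forall n i, a n i 0 <= b n i 0,
          A `<=` \bigcup_(n in J)
            [set x | forall i, a n i 0 <= x i 0 <= b n i 0] &
          v = (\esum_(n in J) (\prod_i (b n i 0 - a n i 0))%:E)%E]].

(* Main.v *)
Require Import Defs.
From HB Require Import structures.
From mathcomp Require Import all_boot all_order all_algebra.
From mathcomp Require Import all_classical all_reals all_analysis.
From mathcomp Require Import ring lra.
Import Order.TTheory GRing.Theory Num.Theory.
Import numFieldNormedType.Exports.

Set Implicit Arguments.
Unset Strict Implicit.
Unset Printing Implicit Defensive.

Local Open Scope classical_set_scope.
Local Open Scope ring_scope.

(** Instead of a Kurdyka-Lojasiewicz argument, we use that every projection
    [P (D x)] is [D x] with all coordinates outside some index set [I] set to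
    zero.  For a fixed [I], one step of the iteration is a contraction, with a
    factor and a norm that do not depend on [I].  Since the objective decreases,
    the steps [x n - x n.+1] tend to 0, so two late iterates with the same [I]
    are close to each other; as there are finitely many sets [I], the sequence
    is Cauchy.  If the limit is unambiguous, then [I] is eventually constant:
    the limit is a fixed point of the corresponding contraction, which gives
    both stationarity and the linear rate.

    For the second part, the ambiguous points lie on the hyperplanes
    [(d_i - d_j) x = 0] and [(d_i + d_j) x = 0] with [i != j]. *)

(** * Euclidean norm *)

Definition dot (R : realType) n (u v : 'cV[R]_n) : R := \sum_i u i 0 * v i 0.

Section Euclidean.
Context (R : realType).

Lemma dotC n (u v : 'cV[R]_n) : dot u v = dot v u.
Proof. by apply: eq_bigr => i _; rewrite mulrC. Qed.

Lemma dotDl n (u v w : 'cV[R]_n) : dot (u + v) w = dot u w + dot v w.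
Proof. by rewrite -big_split; apply: eq_bigr => i _; rewrite mxE mulrDl. Qed.

Lemma dotZl n a (u w : 'cV[R]_n) : dot (a *: u) w = a * dot u w.
Proof. by rewrite mulr_sumr; apply: eq_bigr => i _; rewrite mxE mulrA. Qed.

Lemma dotNl n (u w : 'cV[R]_n) : dot (- u) w = - dot u w.
Proof. by rewrite -scaleN1r dotZl mulN1r. Qed.

Lemma dotDr n (u v w : 'cV[R]_n) : dot w (u + v) = dot w u + dot w v.
Proof. by rewrite dotC dotDl !(dotC w). Qed.

Lemma dotZr n a (u w : 'cV[R]_n) : dot w (a *: u) = a * dot w u.
Proof. by rewrite dotC dotZl dotC. Qed.

Lemma dotNr n (u w : 'cV[R]_n) : dot w (- u) = - dot w u.
Proof. by rewrite dotC dotNl dotC. Qed.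

Definition dotE := (dotDl, dotDr, dotZl, dotZr, dotNl, dotNr).

Lemma dot_mulmxl m n (A : 'M[R]_(m, n)) (u : 'cV[R]_n) (v : 'cV[R]_m) :
  dot (A *m u) v = dot u (A^T *m v).
Proof.
rewrite /dot; under eq_bigr do rewrite mxE mulr_suml.
rewrite exchange_big; apply: eq_bigr => j _ /=; rewrite mxE mulr_sumr.
by apply: eq_bigr => i _; rewrite mxE mulrCA mulrA mulrAC mulrC mulrA.
Qed.

Lemma dot_delta n (i : 'I_n) (v : 'cV[R]_n) : dot (delta_mx i 0) v = v i 0.
Proof.
rewrite /dot (bigD1 i) //= big1 => [|j /negPf ji]; rewrite mxE ?eqxx ?ji.
  by rewrite /= mul1r addr0.
by rewrite mul0r.
Qed.

Lemma enorm_ge0 n (u : 'cV[R]_n) : 0 <= enorm u.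
Proof. exact: sqrtr_ge0. Qed.

Lemma sqr_enorm n (u : 'cV[R]_n) : enorm u ^+ 2 = dot u u.
Proof.
rewrite sqr_sqrtr; last by apply: sumr_ge0 => i _; exact: sqr_ge0.
by apply: eq_bigr => i _; rewrite expr2.
Qed.

Lemma dot_ge0 n (u : 'cV[R]_n) : 0 <= dot u u.
Proof. by rewrite -sqr_enorm sqr_ge0. Qed.

Lemma enormN n (u : 'cV[R]_n) : enorm (- u) = enorm u.
Proof. by congr Num.sqrt; apply: eq_bigr => i _; rewrite mxE sqrrN. Qed.

Lemma enorm_distC n (u v : 'cV[R]_n) : enorm (u - v) = enorm (v - u).
Proof. by rewrite -enormN opprB. Qed.

(** Cauchy-Schwarz: when [dot v v] is nonzero, expand [0 <= dot w w] for
    [w = dot v v *: u - dot u v *: v] and divide by [dot v v]. *)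
Lemma dot_le n (u v : 'cV[R]_n) : dot u v <= enorm u * enorm v.
Proof.
have [v0|v0] := eqVneq (dot v v) 0.
  have {}v0 i : v i 0 = 0.
    apply/eqP; rewrite -sqrf_eq0 expr2; move/eqP: v0.
    rewrite psumr_eq0 => [/allP/(_ i)|j _]; last by rewrite -expr2 sqr_ge0.
    by rewrite mem_index_enum; exact.
  rewrite /dot big1 => [|i _]; last by rewrite v0 mulr0.
  by rewrite mulr_ge0 ?enorm_ge0.
have {v0} v0 : 0 < dot v v by rewrite lt_def v0 dot_ge0.
rewrite (le_trans (ler_norm _))// -ler_sqr ?nnegrE ?mulr_ge0 ?enorm_ge0//.
rewrite real_normK ?num_real// exprMn !sqr_enorm.
have := dot_ge0 (dot v v *: u - dot u v *: v).
by rewrite !dotE (dotC v u) => ?; rewrite -(ler_pM2r v0); lra.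
Qed.

Lemma enormD n (u v : 'cV[R]_n) : enorm (u + v) <= enorm u + enorm v.
Proof.
rewrite -ler_sqr ?nnegrE ?addr_ge0 ?enorm_ge0//.
rewrite sqrrD !sqr_enorm !dotE (dotC v u).
by have := dot_le u v; lra.
Qed.

Lemma enorm_triangle n (w u v : 'cV[R]_n) :
  enorm (u - v) <= enorm (u - w) + enorm (w - v).
Proof. by rewrite (le_trans _ (enormD _ _))// addrA subrK. Qed.

Lemma norm_coord_le n (u : 'cV[R]_n) i : `|u i 0| <= enorm u.
Proof.
rewrite -ler_sqr ?nnegrE ?enorm_ge0// sqr_enorm real_normK ?num_real//.
rewrite /dot (bigD1 i)//= -expr2 lerDl sumr_ge0// => j _.
by rewrite -expr2 sqr_ge0.
Qed.

Lemma enorm_le_sum n (u : 'cV[R]_n) : enorm u <= \sum_i `|u i 0|.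
Proof.
rewrite -ler_sqr ?nnegrE ?enorm_ge0 ?sumr_ge0// sqr_enorm expr2 mulr_suml.
apply: ler_sum => i _; rewrite (le_trans (ler_norm _))// normrM ler_wpM2l//.
by rewrite (bigD1 i)//= lerDl sumr_ge0.
Qed.

Lemma enorm_mulmx_le m n (A : 'M[R]_(m, n)) :
  exists2 C, 0 < C & forall u, enorm (A *m u) <= C * enorm u.
Proof.
(* The summand 1 keeps the constant positive even for [A = 0]; [energy_rate] relies on this. *)
exists (1 + \sum_i \sum_j `|A i j|).
  by rewrite ltr_wpDr// sumr_ge0// => i _; rewrite sumr_ge0.
move=> u; have H i : `|(A *m u) i 0| <= (\sum_j `|A i j|) * enorm u.
  rewrite mxE (le_trans (ler_norm_sum _ _ _))// mulr_suml ler_sum// => j _.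
  by rewrite normrM ler_wpM2l// norm_coord_le.
apply: (le_trans (enorm_le_sum _)); rewrite mulrDl mul1r ler_wpDl ?enorm_ge0//.
by rewrite mulr_suml ler_sum.
Qed.

Lemma dot_colmx m n (u u' : 'cV[R]_m) (v v' : 'cV[R]_n) :
  dot (col_mx u v) (col_mx u' v') = dot u u' + dot v v'.
Proof.
rewrite /dot big_split_ord /=; congr (_ + _); apply: eq_bigr => i _.
  by rewrite !col_mxEu.
by rewrite !col_mxEd.
Qed.

Lemma cauchy_enorm_cvg n (x : nat -> 'cV[R]_n) :
  (forall e, 0 < e -> exists N, forall i j, (N <= i)%N -> (i <= j)%N ->
     enorm (x i - x j) <= e) ->
  exists l : 'cV[R]_n, x @ \oo --> l.
Proof.
move=> xC; suff : cvg (x @ \oo) by exists (lim (x @ \oo)).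
apply: cauchy_cvg; apply/cauchy_exP => e e0.
have [|N xN] := xC (e / 2); first by rewrite divr_gt0.
exists (x N), N => // j /= Nj; split=> // i k; rewrite /ball/=.
have := le_trans (norm_coord_le (x N - x j) i) (xN _ _ (leqnn N) Nj).
by rewrite !mxE (ord1 k) => /le_lt_trans; apply; lra.
Qed.

Lemma enorm_le_norm n (u : 'cV[R]_n) : enorm u <= n%:R * `|u|.
Proof.
rewrite (le_trans (enorm_le_sum _))// mulr_natl.
have <- : \sum_(i < n) `|u| = `|u| *+ n by rewrite sumr_const card_ord.
rewrite ler_sum// => i _; rewrite [`|u|]mx_normrE.
exact: (le_bigmax _ (fun ij => `|u ij.1 ij.2|) (i, 0)).
Qed.

Lemma norm_le_enorm n (u : 'cV[R]_n) : `|u| <= enorm u.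
Proof.
rewrite [`|u|]mx_normrE; apply/bigmax_leP; split=> [|[i j] _]/=.
  exact: enorm_ge0.
by rewrite (ord1 j) norm_coord_le.
Qed.

(** The topology comes from the max norm, which [enorm_le_norm] and [norm_le_enorm] show equivalent
    to the Euclidean norm. *)
Lemma cvg_enormP n (x : nat -> 'cV[R]_n) (l : 'cV[R]_n) :
  x @ \oo --> l <-> (fun k => enorm (x k - l)) @ \oo --> (0 : R).
Proof.
split=> xl.
  apply: (@squeeze_cvgr _ _ _ _ (fun=> 0) (fun k => n%:R * `|x k - l|)).
  - by apply: nearW => k; rewrite enorm_ge0 enorm_le_norm.
  - exact: cvg_cst.
  - rewrite -[0](mulr0 n%:R); apply: cvgMl_tmp.
    apply/norm_cvg0P; rewrite -(subrr l).
    by apply: cvgB => //; exact: cvg_cst.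
apply/cvgrPdist_le => e e0; have /cvgrPdist_le /(_ e e0) := xl.
apply: filterS => k; rewrite sub0r normrN ger0_norm ?enorm_ge0// => H.
by rewrite (le_trans (norm_le_enorm _))// enorm_distC.
Qed.

End Euclidean.

(** * Sparse vectors *)

Definition keep (R : realType) m (I : {set 'I_m}) (y : 'cV[R]_m) : 'cV[R]_m :=
  \col_i (if i \in I then y i 0 else 0).

Section Sparsity.
Context (R : realType) (m : nat).
Implicit Types (y s : 'cV[R]_m) (I J : {set 'I_m}).

Lemma keepB I y s : keep I y - keep I s = keep I (y - s).
Proof.
by apply/colP => i; rewrite !mxE; case: ifP => //; rewrite ?mxE ?subr0.
Qed.

Lemma dot_keep I y : dot (keep I y) (keep I y) = \sum_(i in I) y i 0 ^+ 2.
Proof.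
rewrite [RHS]big_mkcond; apply: eq_bigr => i _ /=; rewrite mxE.
by case: ifP => // _; rewrite mulr0.
Qed.

Lemma enorm_keep_le I y : enorm (keep I y) <= enorm y.
Proof.
rewrite -ler_sqr ?nnegrE ?enorm_ge0// !sqr_enorm dot_keep big_mkcond.
by apply: ler_sum => i _; case: ifP => _; rewrite -?expr2// sqr_ge0.
Qed.

Lemma dot_sub_keep I y :
  dot (y - keep I y) (y - keep I y) = dot y y - \sum_(i in I) y i 0 ^+ 2.
Proof.
apply/eqP; rewrite -subr_eq opprK big_mkcond -big_split /=; apply/eqP.
apply: eq_bigr => i _; rewrite !mxE.
by case: ifP => _; rewrite ?subrr ?subr0 ?mulr0 ?add0r ?addr0 ?expr2.
Qed.

Lemma sparse_keep k I y : (#|I| <= k)%N -> sparse R m k (keep I y).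
Proof.
move=> Ik; apply: leq_trans Ik; apply: subset_leq_card.
by apply/fintype.subsetP => i; rewrite !inE mxE; case: ifP => //; rewrite eqxx.
Qed.

Lemma closest_le k y s s' : closest (sparse R m k) y s -> sparse R m k s' ->
  enorm (y - s) <= enorm (y - s').
Proof.
move=> [_ ->] ss'; apply: ge_inf; last by exists s'.
by exists 0 => _ [z _ <-]; exact: enorm_ge0.
Qed.

(** Take for [I] the support of [s]. The squared error of [s] is that of [keep I y] plus the square
    of [keep I y - s], so optimality makes the latter vanish. Comparing [s] with [keep J y] gives
    the maximality of [I]. *)
Lemma closest_sparse k y s : closest (sparse R m k) y s ->
  exists I, [/\ (#|I| <= k)%N, s = keep I y &
    forall J, (#|J| <= k)%N ->
      \sum_(i in J) y i 0 ^+ 2 <= \sum_(i in I) y i 0 ^+ 2].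
Proof.
move=> cs; pose I := finset (fun i => s i 0 != 0); have Ik : (#|I| <= k)%N.
  by rewrite cardsE; have [] := cs.
have {}cs J : (#|J| <= k)%N -> dot (y - s) (y - s) <=
    dot (y - keep J y) (y - keep J y).
  move=> /(@sparse_keep _ _ y)/(closest_le cs).
  by rewrite -ler_sqr ?nnegrE ?enorm_ge0// !sqr_enorm.
have sI : s = keep I y.
  have dec : dot (y - s) (y - s) =
      dot (y - keep I y) (y - keep I y)
      + dot (keep I y - s) (keep I y - s).
    rewrite -big_split; apply: eq_bigr => i _; rewrite !mxE !inE.
    by case: eqVneq => [->|_] /=; ring.
  have : dot (keep I y - s) (keep I y - s) <= 0.
    by have := cs I Ik; rewrite dec; lra.
  move=> le0; apply/colP => i; apply/eqP; rewrite -subr_eq0 -normr_eq0.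
  rewrite -normrN opprB eq_le normr_ge0 andbT.
  have := norm_coord_le (keep I y - s) i; rewrite !mxE => /le_trans; apply.
  by rewrite -[enorm _]ger0_norm ?enorm_ge0// -sqrtr_sqr sqr_enorm ler0_sqrtr.
exists I; split=> // J Jk; have := cs J Jk; rewrite sI.
by rewrite !dot_sub_keep; lra.
Qed.

(** If the index set [I] of [s] left [J], trading [I :\: J] for the at least as numerous and
    strictly larger entries on [J :\: I] would contradict its maximality. *)
Lemma unambiguous_closest k y J : #|J| = k ->
  (forall i j, i \in J -> j \notin J -> `|y j 0| < `|y i 0|) ->
  forall s, closest (sparse R m k) y s -> s = keep J y.
Proof.
move=> Jk Jy s /closest_sparse[I [Ik -> /(_ J)]].
rewrite Jk leqnn => /(_ isT).
rewrite (big_setID I)/= [leRHS](big_setID J)/= finset.setIC lerD2l => le.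
have IJ : I :\: J = finset.set0.
  apply: contraPeq le => /finset.set0Pn[i0]; rewrite inE => /andP[i0J i0I]; apply/negP.
  rewrite -ltNge.
  have cIJ : (#|I :\: J| <= #|J :\: I|)%N.
    by rewrite -(leq_add2l #|I :&: J|) {2}finset.setIC !cardsID Jk.
  (* [M] separates the two sums: that over [I :\: J] is at most [M *+ #|I :\: J|], and that over
     [J :\: I] exceeds [M *+ #|J :\: I|]. *)
  pose M := \big[Num.max/0]_(i in I :\: J) y i 0 ^+ 2.
  have My i j : i \in J -> j \in I :\: J -> y j 0 ^+ 2 < y i 0 ^+ 2.
    rewrite inE => iJ /andP[jJ _]; rewrite -[ltLHS]real_normK ?num_real//.
    by rewrite -[ltRHS]real_normK ?num_real// ltr_sqr ?nnegrE// Jy.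
  have i0IJ : i0 \in I :\: J by rewrite inE i0J.
  have JI0 : (0 < #|J :\: I|)%N.
    by apply: leq_trans cIJ; apply/card_gt0P; exists i0.
  have ltM i : i \in J -> M < y i 0 ^+ 2.
    move=> iJ; apply/bigmax_ltP; split=> [|j]; last exact: My.
    by apply: le_lt_trans (My _ _ iJ i0IJ); exact: sqr_ge0.
  apply: (@le_lt_trans _ _ (\sum_(i in I :\: J) M)).
    by apply: ler_sum => i iIJ; apply: le_bigmax_cond.
  rewrite sumr_const; apply: (@le_lt_trans _ _ (M *+ #|J :\: I|)).
    by rewrite ler_wpMn2l //; apply: bigmax_ge_id.
  rewrite -sumr_const; have /card_gt0P[i1 i1JI] := JI0.
  rewrite (bigD1 i1)//= [ltRHS](bigD1 i1)//=; apply: ltr_leD.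
    by apply: ltM; move: i1JI; rewrite inE => /andP[].
  by apply: ler_sum => i; rewrite inE => /andP[/andP[_ /ltM/ltW]].
(* [I] may still be a proper subset of [J], but maximality then makes [y] vanish on [J :\: I], so
   both sets keep the same vector. *)
move: le; rewrite IJ big_set0 => le; have {}le : \sum_(i in J :\: I) y i 0 ^+ 2 == 0.
  by rewrite eq_le le sumr_ge0// => i _; exact: sqr_ge0.
rewrite psumr_eq0 in le; last by move=> i _; exact: sqr_ge0.
apply/colP => i; rewrite !mxE; case: ifP => iI; case: ifP => iJ //.
  by move/setP/(_ i) : IJ; rewrite !inE iI iJ.
move/allP : le => /(_ i); rewrite mem_index_enum inE iI iJ sqrf_eq0 /=.
by move=> /(_ isT)/eqP.
Qed.

(* Greedy selection of the [k] largest magnitudes. *)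
Lemma distinct_unambiguous k y : (k <= m)%N ->
  (forall i j, i != j -> `|y i 0| != `|y j 0|) -> unambiguous k y.
Proof.
move=> km ydist; elim: k km => [|k IHk] km.
  by exists finset.set0; rewrite cards0; split=> // i j; rewrite inE.
have [I [Ik Iy]] := IHk (ltnW km).
have /finset.set0Pn[i0 i0I] : ~: I != finset.set0.
  by rewrite -card_gt0 -(ltn_add2l #|I|) cardsC card_ord Ik addn0.
have [i /= Ii imax] := arg_maxP (fun i => `|y i 0|) i0I.
have iI : i \in ~: I := Ii.
exists (i |: I); split; first by rewrite cardsU1 -finset.in_setC iI Ik.
move=> i' j; rewrite !inE negb_or => /orP[/eqP->|i'I] /andP[ji jI].
  by rewrite lt_neqAle ydist// imax//; change (j \in ~: I); rewrite inE.
exact: Iy.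
Qed.

End Sparsity.

(** * Limits of vectors *)

Section Convergence.
Context (R : realType).

Lemma cvg_mulmx m n (A : 'M[R]_(m, n)) (x : nat -> 'cV[R]_n) (l : 'cV[R]_n) :
  x @ \oo --> l -> (fun k => A *m x k) @ \oo --> A *m l.
Proof.
move=> /cvg_enormP xl; apply/cvg_enormP; have [C _ AC] := enorm_mulmx_le A.
apply: (@squeeze_cvgr _ _ _ _ (fun=> 0) (fun k => C * enorm (x k - l))).
- by apply: nearW => k; rewrite enorm_ge0 -mulmxBr AC.
- exact: cvg_cst.
- by rewrite -[0](mulr0 C); exact: cvgMl_tmp.
Qed.

Lemma cvg_keep m (J : {set 'I_m}) (x : nat -> 'cV[R]_m) (l : 'cV[R]_m) :
  x @ \oo --> l -> (fun k => keep J (x k)) @ \oo --> keep J l.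
Proof.
move=> /cvg_enormP xl; apply/cvg_enormP.
apply: (@squeeze_cvgr _ _ _ _ (fun=> 0) (fun k => enorm (x k - l))) => //.
- by apply: nearW => k; rewrite enorm_ge0 keepB enorm_keep_le.
- exact: cvg_cst.
Qed.

Lemma cvg_enorm n (x : nat -> 'cV[R]_n) (l : 'cV[R]_n) :
  x @ \oo --> l -> (fun k => enorm (x k)) @ \oo --> enorm l.
Proof.
move=> /cvg_enormP/cvgrPdist_le xl; apply/cvgrPdist_le => e /xl.
apply: filterS => k; rewrite sub0r normrN ger0_norm ?enorm_ge0//.
have := enormD (x k - l) l; have := enormD (l - x k) (x k).
by rewrite !subrK (enorm_distC l) ler_norml => *; apply/andP; split; lra.
Qed.

Lemma unambiguous_near m (y : 'cV[R]_m) (u : nat -> 'cV[R]_m) (J : {set 'I_m}) :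
  u @ \oo --> y ->
  (forall i j, i \in J -> j \notin J -> `|y j 0| < `|y i 0|) ->
  \forall k \near \oo,
    forall i j, i \in J -> j \notin J -> `|u k j 0| < `|u k i 0|.
Proof.
move=> /cvg_enormP/cvgrPdist_lt uy Jy.
(* The smallest margin between magnitudes inside and outside [J]; the default 1 keeps it positive
   when [J] or its complement is empty. Moving every coordinate by less than half of it preserves
   the order. *)
pose gap := \big[Num.min/1]_(ij | (ij.1 \in J) && (ij.2 \notin J))
  (`|y ij.1 0| - `|y ij.2 0|).
have gap0 : 0 < gap.
  apply/bigmin_gtP; split=> [|[i j]]; first exact: ltr01.
  by move=> /andP[iJ jJ]; rewrite subr_gt0 Jy.
have {}uy := uy (gap / 2) (divr_gt0 gap0 (ltr0Sn _ 1)).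
apply: filterS uy => k; rewrite sub0r normrN ger0_norm ?enorm_ge0// => uk i j iJ jJ.
have le1 : gap <= `|y i 0| - `|y j 0|.
  by rewrite /gap (bigminD1 (i, j)) ?iJ//= ge_min lexx.
have := norm_coord_le (u k - y) i; have := norm_coord_le (u k - y) j.
rewrite !mxE; have := ler_distD 0 (u k i 0) (y i 0).
have := lerB_dist (y i 0) (u k i 0); have := lerB_dist (u k j 0) (y j 0).
by rewrite (distrC (y i 0)); lra.
Qed.

(** The sequence [v] converges, being nonincreasing and bounded below, so its consecutive
    differences tend to 0, and they dominate [s]. *)
Lemma decrease_cvg0 (v s : nat -> R) (b : R) : (forall n, 0 <= s n) ->
  (forall n, v n.+1 + s n <= v n) -> (forall n, b <= v n) -> s @ \oo --> 0.
Proof.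
move=> s0 vs vb; have vcvg : cvg (v @ \oo).
  apply: nonincreasing_is_cvgn; last by exists b => _ [n _ <-].
  by apply/nonincreasing_seqP => n; have := vs n; have := s0 n; lra.
apply: (@squeeze_cvgr _ _ _ _ (fun=> 0) (fun n => v n - v n.+1)).
- by apply: nearW => n; rewrite s0 /=; have := vs n; lra.
- exact: cvg_cst.
- rewrite -(subrr (lim (v @ \oo))); apply: cvgB => //.
  by rewrite (cvg_shiftS v).
Qed.

(* From [i], jump to the last index at most [j] carrying the label of [i], then
   make one step: each label is used at most once. *)
Lemma labelled_dist_le (T : finType) (lab : nat -> T) (d : nat -> nat -> R)
    (e : R) (K : nat) : 0 <= e ->
  (forall i j k, d i k <= d i j + d j k) ->
  (forall i, (K <= i)%N -> d i i.+1 <= e) ->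
  (forall i j, (K <= i)%N -> (i <= j)%N -> lab i = lab j -> d i j <= e) ->
  forall i j, (K <= i)%N -> (i <= j)%N -> d i j <= 2 * e * #|T|%:R.
Proof.
move=> e0 dtri dstep dlab i j Ki ij.
(* Induction on a set [A] containing all labels from [i] to [j]. Each label costs [2 * e]: one [e]
   for the jump, one for the step after it. *)
suff H (A : {set T}) : (forall l, (i <= l <= j)%N -> lab l \in A) ->
    d i j <= 2 * e * #|A|%:R.
  by rewrite -cardsT; apply: H => l _; rewrite finset.in_setT.
have [n] := ubnP #|A|; elim: n A i Ki ij => // n IHn A i Ki ij cA Alab.
have iA : lab i \in A by apply: Alab; rewrite leqnn.
have exl : exists l, (i <= l <= j)%N && (lab l == lab i).
  by exists i; rewrite leqnn ij eqxx.
have [l /andP[/andP[il lj] /eqP labl] lmax] := @ex_maxnP _ j exl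
  (fun l h => proj2 (andP (proj1 (andP h)))).
have cA1 := cardsD1 (lab i) A; rewrite iA add1n in cA1.
have dil : d i l <= e by exact: dlab.
rewrite cA1 -(natr1 #|A :\ lab i|) mulrDr mulr1.
have [lj'|jl] := ltnP l j; last first.
  have -> : j = l by apply/eqP; rewrite eqn_leq jl.
  have : 0 <= 2 * e * #|A :\ lab i|%:R by rewrite !mulr_ge0.
  lra.
have Kl : (K <= l)%N by exact: leq_trans il.
have := dtri i l j; have := dtri l l.+1 j; have := dstep l Kl.
have : d l.+1 j <= 2 * e * #|A :\ lab i|%:R.
  apply: IHn => //; first exact: leqW.
    by rewrite cA1 in cA.
  move=> l' /andP[ll' l'j]; rewrite !inE Alab ?l'j ?andbT; last first.
    by rewrite (leq_trans il)// ltnW.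
  apply/eqP => labl'; have := lmax l'.
  by rewrite labl' eqxx l'j (leq_trans il (ltnW ll')) leqNgt ll' => /(_ isT).
lra.
Qed.

End Convergence.

(** * The proximal step *)

Definition prox_objective (R : realType) m p (D : 'M[R]_(m, p))
    (f : 'cV[R]_p -> R) (rho : R) (z : 'cV[R]_m) (y : 'cV[R]_p) : R :=
  f y + rho / 2 * enorm (D *m y - z) ^+ 2.

Section ProximalStep.
Context (R : realType) (m p : nat) (D : 'M[R]_(m, p)) (f : 'cV[R]_p -> R).
Context (mu rho : R) (mu0 : 0 < mu) (rho0 : 0 < rho).
Context (fmu : forall (x y : 'cV[R]_p) (t : R), 0 <= t <= 1 ->
  f (t *: x + (1 - t) *: y) <=
    t * f x + (1 - t) * f y - mu / 2 * t * (1 - t) * enorm (x - y) ^+ 2).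

Local Notation prox_obj := (prox_objective D f rho).

(** Comparing [a] with the point [t *: y + (1 - t) *: a] and dividing by [t] gives [H]; the claim is
    its limit as [t] tends to 0. *)
Lemma prox_growth z a : argmin (prox_obj z) a -> forall y,
  prox_obj z a + (mu / 2 * enorm (y - a) ^+ 2
    + rho / 2 * enorm (D *m (y - a)) ^+ 2) <= prox_obj z y.
Proof.
move=> amin y; set Q := (X in _ + X).
have Q0 : 0 <= Q.
  by rewrite addr_ge0// mulr_ge0 ?sqr_ge0// divr_ge0// ltW.
have H t : 0 < t -> t <= 1 -> (1 - t) * Q <= prox_obj z y - prox_obj z a.
  move=> t0 t1; rewrite -(ler_pM2l t0).
  have t01 : 0 <= t <= 1 by rewrite ltW.
  have := le_trans (amin (t *: y + (1 - t) *: a)) (lerD (fmu y a t01) (lexx _)).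
  rewrite /prox_objective /Q.
  have -> : D *m (t *: y + (1 - t) *: a) - z =
      (D *m a - z) + t *: (D *m (y - a)).
    rewrite mulmxBr mulmxDr -!scalemxAr.
    by move: (D *m y) (D *m a) => y' a'; apply/colP => i; rewrite !mxE; ring.
  have -> : D *m y - z = (D *m a - z) + D *m (y - a).
    by rewrite mulmxBr [RHS]addrC addrA subrK.
  rewrite !(sqr_enorm (_ + _)) !sqr_enorm !dotE (dotC (D *m (y - a)) (D *m a)).
  rewrite (dotC (D *m (y - a)) z).
  lra.
(* The limit is replaced by one value of [t]. With [G] the increase of the objective, [t = 1] gives
   [0 <= G]; if [G < Q], then [t = (Q - G) / (2 * Q)] yields [(Q + G) / 2 <= G], a contradiction. *)
rewrite -lerBrDl leNgt; apply/negP => ltQ; have := H 1 ltr01 (lexx _).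
rewrite subrr mul0r => G0; have Qgt0 := le_lt_trans G0 ltQ.
have := H ((Q - (prox_obj z y - prox_obj z a)) / (2 * Q)).
set G := prox_obj z y - _ in G0 ltQ *.
have -> : (1 - (Q - G) / (2 * Q)) * Q = (Q + G) / 2 by field; rewrite gt_eqF.
rewrite divr_gt0 ?ler_pdivrMr ?mulr_gt0 ?subr_gt0// mul1r.
by move=> /(_ isT); rewrite lerBlDr => /(_ _); lra.
Qed.

(** In the growth inequality the terms quadratic in [D *m (y - a)] cancel; completing the square in
    what remains, [mu / 2 * dot (y - a) (y - a) - rho * dot (y - a) c], gives the bound. *)
Lemma prox_bounded_below z a : argmin (prox_obj z) a -> exists b, forall y, b <= f y.
Proof.
move=> /prox_growth H; pose c := D^T *m (D *m a - z).
exists (prox_obj z a - rho / 2 * enorm (D *m a - z) ^+ 2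
  - rho ^+ 2 / (2 * mu) * dot c c) => y.
have := H y; rewrite /prox_objective.
have -> : D *m y - z = (D *m a - z) + D *m (y - a).
  by rewrite mulmxBr [RHS]addrC addrA subrK.
have dc : dot (D *m (y - a)) (D *m a - z) = dot (y - a) c.
  by rewrite dot_mulmxl.
rewrite !(sqr_enorm (_ + D *m (y - a))) (dotDl (D *m a - z)) !(dotDr (D *m a - z)).
rewrite (dotC (D *m a - z) (D *m (y - a))) dc !sqr_enorm.
have := dot_ge0 (y - a - (rho / mu) *: c).
rewrite !(dotDl (y - a)) !(dotDr (y - a)) !(dotNl, dotNr, dotZl, dotZr) (dotC c (y - a)).
rewrite -(pmulr_rge0 _ (divr_gt0 mu0 (ltr0Sn _ 1))).
set X := dot (y - a) (y - a); set Y := dot (y - a) c; set Z := dot c c.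
have -> : mu / 2 * (X - rho / mu * Y + (- (rho / mu * Y) - rho / mu * - (rho / mu * Z)))
  = mu / 2 * X - rho * Y + rho ^+ 2 / (2 * mu) * Z by field; rewrite gt_eqF.
lra.
Qed.

(* Up to a constant factor, the Hessian of [prox_obj z] is at least the
   quadratic form [u |-> |energy_mx u|^2], in which a step with fixed support
   is a contraction. *)
Definition energy_mx : 'M[R]_(p + m, p) :=
  col_mx (Num.sqrt (2 * mu))%:M (Num.sqrt rho *: D).

Lemma sqr_energy u :
  enorm (energy_mx *m u) ^+ 2 = 2 * mu * enorm u ^+ 2 + rho * enorm (D *m u) ^+ 2.
Proof.
rewrite mul_col_mx mul_scalar_mx -scalemxAl !sqr_enorm dot_colmx !dotE !mulrA.
by rewrite -!expr2 !sqr_sqrtr ?mulr_ge0// ltW.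
Qed.

(** In the sum of the two growth inequalities [f] cancels, leaving
    [rho * dot (D *m (a - b)) (z - w)] as upper bound. The square of [D *m (a - b) - (z - w)] splits
    this product, and [keep I] does not increase norms. *)
Lemma prox_step_contraction I x y a b :
  argmin (prox_obj (keep I (D *m x))) a ->
  argmin (prox_obj (keep I (D *m y))) b ->
  enorm (energy_mx *m (a - b)) ^+ 2 <= rho * enorm (D *m (x - y)) ^+ 2.
Proof.
move=> /prox_growth/(_ b) Ha /prox_growth/(_ a) Hb; rewrite sqr_energy.
have := enorm_keep_le I (D *m (x - y)).
rewrite {1}mulmxBr -keepB -ler_sqr ?nnegrE ?enorm_ge0// -(ler_pM2l rho0).
rewrite (enorm_distC b) -(enormN (D *m (b - a))) -mulmxN opprB in Ha.
move: Ha Hb; rewrite /prox_objective.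
set z := keep I (D *m x); set w := keep I (D *m y); set d := enorm (D *m (x - y)).
have := mulr_ge0 (ltW rho0) (dot_ge0 (D *m a - D *m b - (z - w))).
rewrite (mulmxBr D a b) !(sqr_enorm (_ - z)) !(sqr_enorm (_ - w)).
rewrite (sqr_enorm (D *m a - _)) !dotE.
rewrite (dotC (D *m b) (D *m a)) !(dotC z) !(dotC w (D *m _)).
lra.
Qed.

(** The term [2 * mu * enorm u ^+ 2] of the energy is at least a fixed fraction of
    [enorm (D *m u) ^+ 2], which leaves the factor [t = q ^+ 2] below 1. *)
Lemma energy_rate : exists2 q, 0 < q < 1 &
  forall u, rho * enorm (D *m u) ^+ 2 <= (q * enorm (energy_mx *m u)) ^+ 2.
Proof.
have [C C0 DC] := enorm_mulmx_le D.
pose t := rho * C ^+ 2 / (rho * C ^+ 2 + 2 * mu).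
have a0 : 0 < rho * C ^+ 2 by rewrite mulr_gt0 ?exprn_gt0.
have b0 : 0 < rho * C ^+ 2 + 2 * mu by rewrite addr_gt0 ?mulr_gt0.
have t0 : 0 < t by rewrite divr_gt0.
have t1 : t < 1 by rewrite ltr_pdivrMr// mul1r ltrDl mulr_gt0.
exists (Num.sqrt t).
  by rewrite sqrtr_gt0 t0 -[ltRHS]sqrtr1 ltr_sqrt.
move=> u; rewrite exprMn (sqr_sqrtr (ltW t0)) sqr_energy.
rewrite /t mulrAC ler_pdivlMr//.
have : enorm (D *m u) ^+ 2 <= C ^+ 2 * enorm u ^+ 2.
  by rewrite -exprMn ler_sqr ?nnegrE ?mulr_ge0 ?enorm_ge0// ltW.
have mr : 0 < 2 * mu * rho by rewrite !mulr_gt0.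
rewrite -(ler_pM2l mr); lra.
Qed.

Lemma enorm_le_energy u :
  enorm u <= (Num.sqrt (2 * mu))^-1 * enorm (energy_mx *m u).
Proof.
have s0 : 0 < Num.sqrt (2 * mu) by rewrite sqrtr_gt0 mulr_gt0.
rewrite ler_pdivlMl// -ler_sqr ?nnegrE ?mulr_ge0 ?enorm_ge0 ?(ltW s0)//.
have mu20 : 0 <= 2 * mu by rewrite mulr_ge0// ltW.
rewrite sqr_energy exprMn (sqr_sqrtr mu20) lerDl.
by rewrite mulr_ge0 ?sqr_ge0 ?(ltW rho0).
Qed.

Lemma prox_stationary z a : differentiable f a -> argmin (prox_obj z) a ->
  gradient f a + rho *: (D^T *m (D *m a - z)) = 0.
Proof.
move=> fa amin; pose c := D^T *m (D *m a - z).
have H v : 0 <= 'D_v f a + rho * dot v c.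
  have /cvg_dnbhs_at_right dv := @diff_derivable _ _ _ f a v fa.
  (* The difference quotient of the objective along [v], with the squared norm expanded; it is
     nonnegative for [h > 0] by minimality. *)
  pose q (h : R) := h^-1 *: (f (h *: v + a) - f a) + rho * dot v c
    + h * (rho / 2 * enorm (D *m v) ^+ 2).
  have : q h @[h --> 0^'+] --> 'D_v f a + rho * dot v c + 0.
    apply: cvgD; first by apply: cvgD => //; exact: cvg_cst.
    rewrite -[0 in X in _ --> X](mul0r (rho / 2 * enorm (D *m v) ^+ 2)).
    by apply: cvgMr_tmp; apply: cvg_at_right_filter; exact: cvg_id.
  rewrite addr0 => /cvgr_to_ge; apply; near=> h.
  have h0 : 0 < h by near: h; exact: nbhs_right_gt.
  rewrite -(pmulr_rge0 _ h0) /q.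
  have := amin (h *: v + a); rewrite /prox_objective.
  have -> : D *m (h *: v + a) - z = (D *m a - z) + h *: (D *m v).
    by rewrite mulmxDr -scalemxAr -addrA addrC.
  rewrite !mulrDr /GRing.scale/= mulVKf ?gt_eqF//.
  have -> : dot v c = dot (D *m v) (D *m a - z) by rewrite dot_mulmxl.
  rewrite !sqr_enorm (dotDl (D *m a - z)) !(dotDr (D *m a - z)).
  rewrite !(dotZl h) !(dotZr h) (dotC (D *m a - z) (D *m v)).
  lra.
rewrite -/c; clearbody c; apply/colP => i; rewrite !mxE.
set v : 'cV_p := delta_mx i 0.
have := H v; have := H (- v).
rewrite !(deriveE _ fa) raddfN/= -(deriveE _ fa) !dotNl dot_delta.
lra.
Unshelve. all: by end_near.
Qed.

End ProximalStep.

(** * Convergence of the iterates *)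

Section Iterates.
Context (R : realType) (m p k : nat) (D : 'M[R]_(m, p)) (f : 'cV[R]_p -> R).
Context (mu rho : R) (mu0 : 0 < mu) (rho0 : 0 < rho).
Context (fmu : forall (x y : 'cV[R]_p) (t : R), 0 <= t <= 1 ->
  f (t *: x + (1 - t) *: y) <=
    t * f x + (1 - t) * f y - mu / 2 * t * (1 - t) * enorm (x - y) ^+ 2).
Context (P : 'cV[R]_m -> 'cV[R]_m) (x : nat -> 'cV[R]_p).
Context (projP : projection (sparse R m k) P).
Context (xP : proximal_distance_iterates D f rho P x).

Local Notation E := (energy_mx D mu rho).
Local Notation prox_obj := (prox_objective D f rho).

Let xP' n : argmin (prox_obj (P (D *m x n))) (x n.+1).
Proof. exact: xP. Qed.

Lemma iterates_step_cvg0 : (fun n => enorm (E *m (x n - x n.+1))) @ \oo --> 0.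
Proof.
have [b fb] := prox_bounded_below mu0 rho0 fmu (xP' 0).
(* Since [P] gives closest points, [v n] is the penalised objective at [x n]; projecting anew at
   [x n.+1] can only lower the value. *)
pose v n := prox_obj (P (D *m x n)) (x n).
(* After division by 4 the [mu] term equals that of [prox_growth], and the [rho] term is half of the
   one there. *)
pose s n := enorm (E *m (x n - x n.+1)) ^+ 2 / 4.
have : s @ \oo --> 0.
  apply: (@decrease_cvg0 _ v s b) => n.
  - by rewrite divr_ge0// sqr_ge0.
  - have := prox_growth mu0 rho0 fmu (xP' n) (x n).
    have : v n.+1 <= prox_obj (P (D *m x n)) (x n.+1).
      have rho20 : 0 < rho / 2 by rewrite divr_gt0.
      rewrite lerD2l (ler_pM2l rho20) ler_sqr ?nnegrE ?enorm_ge0//.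
      exact: (closest_le (projP _) (projP _).1).
    rewrite -/(v n) /s (sqr_energy D mu0 rho0).
    have : 0 <= rho * enorm (D *m (x n - x n.+1)) ^+ 2.
      by rewrite mulr_ge0 ?sqr_ge0// ltW.
    lra.
  - rewrite /v /prox_objective (le_trans (fb (x n)))// lerDl.
    by rewrite mulr_ge0 ?sqr_ge0// divr_ge0// ltW.
move=> /cvgrPdist_le s0; apply/cvgrPdist_le => e e0.
have e20 : 0 < e ^+ 2 / 4 by rewrite divr_gt0// exprn_gt0.
apply: filterS (s0 _ e20) => n; rewrite !sub0r !normrN /s.
rewrite !ger0_norm ?divr_ge0 ?sqr_ge0 ?enorm_ge0//.
by rewrite ler_pM2r ?invr_gt0// ler_sqr ?nnegrE ?enorm_ge0// ltW.
Qed.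

Lemma iterates_cvg : exists l : 'cV[R]_p, x @ \oo --> l.
Proof.
have [n|lab labP] := @choice _ _ (fun n (I : {set 'I_m}) =>
    P (D *m x n) = keep I (D *m x n)).
  by have [I [_ -> _]] := closest_sparse (projP (D *m x n)); exists I.
have [q /andP[q0 q1] qP] := energy_rate D mu0 rho0.
have Elab i j : lab i = lab j ->
    enorm (E *m (x i.+1 - x j.+1)) <= q * enorm (E *m (x i - x j)).
  move=> ij; rewrite -ler_sqr ?nnegrE ?mulr_ge0 ?enorm_ge0 ?(ltW q0)//.
  apply: le_trans (qP _).
  apply: (prox_step_contraction mu0 rho0 fmu (I := lab i)).
    by rewrite -labP.
  by rewrite ij -labP.
apply: cauchy_enorm_cvg => e e0.
pose s := (Num.sqrt (2 * mu))^-1.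
pose T : finType := {set 'I_m}.
have s0 : 0 < s by rewrite invr_gt0 sqrtr_gt0 mulr_gt0.
(* Chosen so that the final bound becomes [(c - 1) * eta], at most [e]; the summand 1 makes [c]
   positive. *)
pose c := s * (2 * (2 / (1 - q)) * #|T|%:R) + 1.
have q10 : 0 < 1 - q by rewrite subr_gt0.
have c0 : 0 < c.
  by rewrite ltr_wpDl// mulr_ge0 ?(ltW s0)// !mulr_ge0// invr_ge0 ltW.
pose eta := e / c; have eta0 : 0 < eta by rewrite divr_gt0.
have /cvgrPdist_le/(_ eta eta0)[K _ KP] := iterates_step_cvg0.
have {}KP i : (K <= i)%N -> enorm (E *m (x i - x i.+1)) <= eta.
  by move=> /KP/=; rewrite sub0r normrN ger0_norm ?enorm_ge0.
have dtri i j l : enorm (E *m (x i - x l)) <=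
    enorm (E *m (x i - x j)) + enorm (E *m (x j - x l)).
  by rewrite !mulmxBr enorm_triangle.
exists K => i j Ki ij; rewrite (le_trans (enorm_le_energy D mu0 rho0 _))// -/s.
have d1 : eta <= 2 / (1 - q) * eta.
  by rewrite ler_peMl ?(ltW eta0)// ler_pdivlMr//; lra.
have : enorm (E *m (x i - x j)) <= 2 * (2 / (1 - q) * eta) * #|T|%:R.
  apply: (@labelled_dist_le _ T lab (fun i j => enorm (E *m (x i - x j))) _ K)
    => //.
  - by rewrite (le_trans _ d1)// ltW.
  - by move=> l /KP/le_trans; apply.
  (* Going through [x i.+1] and [x j.+1], the distance is at most [2 * eta] plus [q] times
     itself. *)
  - move=> {ij}i {}j {}Ki ij /Elab lij; have Kj := leq_trans Ki ij.
    rewrite mulrAC ler_pdivlMr//.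
    have := dtri i i.+1 j; have := dtri i.+1 j.+1 j.
    have := KP _ Ki; have := KP _ Kj.
    rewrite (mulmxBr E (x j)) enorm_distC -mulmxBr; lra.
move=> /(ler_wpM2l (ltW s0))/le_trans; apply.
have -> : s * (2 * (2 / (1 - q) * eta) * #|T|%:R) = (c - 1) * eta.
  by rewrite /c; ring.
rewrite mulrBl mul1r /eta mulrC divfK ?gt_eqF// lerBlDr lerDl.
exact: ltW.
Qed.

Lemma unambiguous_eventually_keep l (J : {set 'I_m}) : x @ \oo --> l ->
  #|J| = k ->
  (forall i j, i \in J -> j \notin J -> `|(D *m l) j 0| < `|(D *m l) i 0|) ->
  \forall n \near \oo, P (D *m x n) = keep J (D *m x n).
Proof.
move=> /(cvg_mulmx (A := D))/unambiguous_near Dx Jk /Dx.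
by apply: filterS => n /(unambiguous_closest Jk)/(_ _ (projP _)).
Qed.

(** The minimality of [x n.+1] against a fixed [y] passes to the limit because [keep J] is
    continuous, whereas [P] may jump. *)
Lemma limit_argmin l (J : {set 'I_m}) : x @ \oo --> l ->
  {for l, continuous f} ->
  (\forall n \near \oo, P (D *m x n) = keep J (D *m x n)) ->
  argmin (prox_obj (keep J (D *m l))) l.
Proof.
move=> xl fl PJ y.
have xSl : (fun n => x n.+1) @ \oo --> l by rewrite (cvg_shiftS x).
have kl := cvg_keep (J := J) (cvg_mulmx (A := D) xl).
have cvg_obj (u : nat -> 'cV[R]_p) (w : 'cV[R]_p) :
    (fun n => f (u n)) @ \oo --> f w -> u @ \oo --> w ->
    (fun n => prox_obj (keep J (D *m x n)) (u n)) @ \oo -->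
    prox_obj (keep J (D *m l)) w.
  move=> fu uw; apply: cvgD => //; apply: cvgMl_tmp; rewrite expr2.
  have uk : (fun n => enorm (D *m u n - keep J (D *m x n))) @ \oo -->
      enorm (D *m w - keep J (D *m l)).
    by apply: cvg_enorm; apply: cvgB => //; exact: cvg_mulmx.
  exact: (cvgM uk uk).
apply: (ler_cvg_to (cvg_obj _ _ _ xSl) (cvg_obj (fun=> y) y _ _)).
- exact: (continuous_cvg _ fl xSl).
- exact: cvg_cst.
- exact: cvg_cst.
- by apply: filterS PJ => n <-; exact: xP.
Qed.

Lemma geometric_bound (u : nat -> R) (q : R) (K : nat) : 0 < q ->
  (forall n, 0 <= u n) -> (forall n, (K <= n)%N -> u n.+1 <= q * u n) ->
  exists2 C, 0 < C & forall n, u n <= C * q ^+ n.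
Proof.
(* The sum dominates each ratio [u i / q ^+ i] with [i <= K], which settles the indices before the
   contraction sets in. *)
move=> q0 u0 uq; pose C := 1 + \sum_(i < K.+1) u i / q ^+ i.
have sum_ge0 (A : pred 'I_K.+1) : 0 <= \sum_(i | A i) u i / q ^+ i.
  by apply: sumr_ge0 => i _; rewrite divr_ge0// exprn_ge0// ltW.
exists C => [|n]; first by rewrite ltr_wpDr.
have leK j : (j <= K)%N -> u j <= C * q ^+ j.
  move=> jK; rewrite -ler_pdivrMr ?exprn_gt0// ler_wpDl//.
  by rewrite (bigD1 (Ordinal (jK : (j < K.+1)%N)))//= lerDl.
elim: n => [|n IHn]; first exact: leK.
have [nK|Kn] := ltnP n K; first exact: leK.
by rewrite (le_trans (uq _ Kn))// exprS mulrCA ler_pM2l.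
Qed.

(** The limit is a fixed point of the step with support [J], so the contraction applies to the pair
    [x n], [l]. *)
Lemma limit_linear_convergence l (J : {set 'I_m}) :
  argmin (prox_obj (keep J (D *m l))) l ->
  (\forall n \near \oo, P (D *m x n) = keep J (D *m x n)) ->
  linear_convergence x l.
Proof.
move=> lmin [K _ KP]; have [q /andP[q0 q1] qP] := energy_rate D mu0 rho0.
have [n|n Kn|C C0 CP] := @geometric_bound
  (fun n => enorm (E *m (x n - l))) q K q0.
- exact: enorm_ge0.
- rewrite -ler_sqr ?nnegrE ?mulr_ge0 ?enorm_ge0 ?(ltW q0)//.
  apply: le_trans (qP _); apply: (prox_step_contraction mu0 rho0 fmu _ lmin).
  by rewrite -(KP n Kn); exact: xP.
exists ((Num.sqrt (2 * mu))^-1 * C), q; split.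
- by rewrite mulr_gt0// invr_gt0 sqrtr_gt0 mulr_gt0.
- by rewrite q0.
- move=> n; rewrite (le_trans (enorm_le_energy D mu0 rho0 _))// -mulrA.
  by rewrite ler_wpM2l// invr_ge0 sqrtr_ge0.
Qed.

End Iterates.

(** * Hyperplanes are null sets *)

Section OuterMeasure.
Context (R : realType) (p : nat).
Implicit Types A B : set 'cV[R]_p.

Lemma lebesgue_outer_ge0 A : (0 <= lebesgue_outer A)%E.
Proof.
apply: le_ereal_inf_tmp => _ [J [a [b [ab _ ->]]]]; apply: esum_ge0 => n _.
by rewrite lee_fin prodr_ge0// => i _; rewrite subr_ge0.
Qed.

Lemma le_lebesgue_outer A B : A `<=` B ->
  (lebesgue_outer A <= lebesgue_outer B)%E.
Proof.
move=> AB; apply: ereal_inf_le_tmp => _ [J [a [b [ab BJ ->]]]].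
by exists J, a, b; split=> //; exact: subset_trans AB BJ.
Qed.

Lemma lebesgue_outer_le_cover (T : countType) (J : set T) (a b : T -> 'cV[R]_p) A :
  (forall t i, a t i 0 <= b t i 0) ->
  A `<=` \bigcup_(t in J) [set x | forall i, a t i 0 <= x i 0 <= b t i 0] ->
  (lebesgue_outer A <= \esum_(t in J) (\prod_i (b t i 0 - a t i 0))%:E)%E.
Proof.
move=> ab AJ; apply: ereal_inf_lbound.
(* Numbers coding no element get the degenerate box at 0; they stay outside the index set of the
   cover. *)
pose ext (c : T -> 'cV[R]_p) n := oapp c 0 (unpickle n).
have extK c t : ext c (pickle t) = c t by rewrite /ext pickleK.
exists (pickle @` J), (ext a), (ext b); split.
- by move=> n i; rewrite /ext; case: (unpickle n) => /=.
- move=> x /AJ[t Jt xt]; exists (pickle t); first by exists t.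
  by move=> i /=; rewrite !extK.
- rewrite esum_image.
    by apply: eq_esum => t _; under [in RHS]eq_bigr do rewrite !extK.
  by move=> s t _ _; exact: (pcan_inj pickleK).
Qed.

Lemma lebesgue_outer0 : lebesgue_outer (@set0 'cV[R]_p) = 0%E.
Proof.
apply/eqP; rewrite eq_le lebesgue_outer_ge0 andbT.
have := @lebesgue_outer_le_cover nat set0 (fun=> 0) (fun=> 0) set0.
by rewrite esum_set0; apply.
Qed.

Lemma lebesgue_outer_le_fincover (T : finType) (a b : T -> 'cV[R]_p) A :
  (forall t i, a t i 0 <= b t i 0) ->
  (forall x, A x -> exists t, forall i, a t i 0 <= x i 0 <= b t i 0) ->
  (lebesgue_outer A <= (\sum_t \prod_i (b t i 0 - a t i 0))%:E)%E.
Proof.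
move=> ab AT; have vol_ge0 t : 0 <= \prod_i (b t i 0 - a t i 0).
  by rewrite prodr_ge0// => i _; rewrite subr_ge0.
apply: le_trans (@lebesgue_outer_le_cover T setT a b A ab _) _.
  by move=> x /AT[t xt]; exists t.
rewrite esum_fset; [|exact: finite_finset|by move=> t _; rewrite lee_fin].
rewrite (fsbigE (enum T)) ?enum_uniq// => [|t _]; last by rewrite mem_enum.
rewrite (eq_bigl xpredT) => [|t]; last by rewrite in_setT.
by rewrite big_enum/= sumEFin.
Qed.

(** Cover [A n] with total volume at most [e / 2 ^ n.+1] and join the covers, indexed by pairs. *)
Lemma lebesgue_outer_bigcup0 (A : nat -> set 'cV[R]_p) :
  (forall n, lebesgue_outer (A n) = 0%E) ->
  lebesgue_outer (\bigcup_n A n) = 0%E.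
Proof.
move=> A0; apply/eqP; rewrite eq_le lebesgue_outer_ge0 andbT.
apply/lee_addgt0Pr => e e0; rewrite add0e.
have cover n : exists c : set nat * ((nat -> 'cV[R]_p) * (nat -> 'cV[R]_p)),
    [/\ forall k i, c.2.1 k i 0 <= c.2.2 k i 0,
      A n `<=` \bigcup_(k in c.1)
        [set x | forall i, c.2.1 k i 0 <= x i 0 <= c.2.2 k i 0] &
      (\esum_(k in c.1) (\prod_i (c.2.2 k i 0 - c.2.1 k i 0))%:E
        <= (e / (2 ^ n.+1)%:R)%:E)%E].
  have : (lebesgue_outer (A n) < (e / (2 ^ n.+1)%:R)%:E)%E.
    by rewrite A0 lte_fin divr_gt0// ltr0n expn_gt0.
  move=> /ereal_inf_lt[_ [J [a [b [ab AJ ->]]]] /ltW lt_e].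
  by exists (J, (a, b)).
have {cover} [c cP] := choice cover.
pose a (t : nat * nat) := (c t.1).2.1 t.2.
pose b (t : nat * nat) := (c t.1).2.2 t.2.
have ab t i : a t i 0 <= b t i 0 by have [+ _ _] := cP t.1; exact.
apply: le_trans (@lebesgue_outer_le_cover (nat * nat)%type
  (setT `*`` (fun n => (c n).1)) a b _ ab _) _.
  move=> x [n _ Anx]; have [_ /(_ _ Anx)[k ck xk] _] := cP n.
  by exists (n, k).
rewrite -(@esum_esum _ _ _ setT (fun n => (c n).1)
  (fun n k => (\prod_i (b (n, k) i 0 - a (n, k) i 0))%:E)); last first.
  by move=> n k _ _; rewrite lee_fin prodr_ge0// => i _; rewrite subr_ge0.
apply: le_trans (epsilon_trick0 xpredT (ltW e0)).
rewrite nneseries_esumT => [|n].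
  by apply: le_esum => n _; have [_ _] := cP n.
by rewrite lee_fin divr_ge0 ?ltW// ler0n.
Qed.

Lemma lebesgue_outer_bigcup_count0 (T : countType) (A : T -> set 'cV[R]_p) :
  (forall t, lebesgue_outer (A t) = 0%E) ->
  lebesgue_outer (\bigcup_t A t) = 0%E.
Proof.
move=> A0; pose A' n := oapp A set0 (unpickle n).
apply/eqP; rewrite eq_le lebesgue_outer_ge0 andbT.
rewrite -(@lebesgue_outer_bigcup0 A') => [|n].
  by apply: le_lebesgue_outer => x [t _ Atx]; exists (pickle t);
    rewrite // /A' pickleK.
rewrite /A'; case: (unpickle n) => [t|] //=.
exact: lebesgue_outer0.
Qed.

End OuterMeasure.

(** * Covering a hyperplane by thin boxes *)

Section Hyperplane.
Context (R : realType) (q : nat) (c : 'cV[R]_q.+1) (i : 'I_q.+1) (ci : c i 0 != 0).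

Let slice M : set 'cV[R]_q.+1 :=
  [set x | dot c x = 0 /\ forall l, `|x (lift i l) 0| < M.+1%:R].

Let slope := \sum_l `|c (lift i l) 0 / c i 0|.

Let slope_ge0 : 0 <= slope. Proof. exact: sumr_ge0. Qed.

(* The cube of side [2 (M + 1)] in the coordinates other than [i] is cut into
   [N ^ q] cells of side [d]; above each cell, [slice M] has height at most
   [2 * slope * d]. *)
Let slice_le M N : (lebesgue_outer (slice M) <=
  (2 * slope * (2 * M.+1%:R) ^+ q.+1 / N.+1%:R)%:E)%E.
Proof.
pose S : R := M.+1%:R; pose d : R := 2 * S / N.+1%:R.
have d0 : 0 < d by rewrite divr_gt0// mulr_gt0// ltr0n.
have dN : 2 * S = d * N.+1%:R by rewrite divfK// pnatr_eq0.
clearbody d.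
pose corner (g : {ffun 'I_q -> 'I_N.+1}) l : R := (g l)%:R * d - S.
pose height g := - \sum_l c (lift i l) 0 / c i 0 * corner g l.
pose a g : 'cV[R]_q.+1 := \col_j if unlift i j is Some l then corner g l
  else height g - slope * d.
pose b g : 'cV[R]_q.+1 := \col_j if unlift i j is Some l then corner g l + d
  else height g + slope * d.
have sd0 : 0 <= slope * d by rewrite mulr_ge0// ltW.
have ab g j : a g j 0 <= b g j 0.
  by rewrite !mxE; case: (unlift i j) => [l|]; lra.
apply: le_trans (lebesgue_outer_le_fincover ab _) _; last first.
  (* All [N.+1 ^ q] boxes have the same volume, and [d * N.+1%:R = 2 * S] turns their sum into the
     stated bound. *)
  have vol g : \prod_j (b g j 0 - a g j 0) = 2 * slope * d * d ^+ q.
    rewrite (bigD1_ord i)//= !mxE unlift_none; congr (_ * _); first by ring.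
    rewrite -[in RHS](card_ord q) -prodr_const; apply: eq_bigr => l _.
    by rewrite !mxE liftK; ring.
  under eq_bigr do rewrite vol.
  rewrite sumr_const card_ffun !card_ord lee_fin -[leLHS]mulr_natr natrX.
  rewrite -/S dN exprMn !exprS; have : (N.+1%:R : R) != 0 by rewrite pnatr_eq0.
  move: (d ^+ q) (_ ^+ q) => dq nq; move: (_.+1%:R) => n n0.
  by rewrite le_eqVlt; apply/orP; left; apply/eqP; field.
move=> x [cx xM].
have xi : x i 0 = - \sum_l c (lift i l) 0 / c i 0 * x (lift i l) 0.
  move: cx; rewrite /dot (bigD1_ord i)//= => /eqP; rewrite addr_eq0 => /eqP cx.
  apply: (mulfI ci); rewrite cx mulrN mulr_sumr; congr (- _).
  by apply: eq_bigr => l _; rewrite mulrA mulrCA divff// mulr1.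
(* The number of the cell containing [x] in direction [l]; the strict inequality in [slice] keeps it
   below [N.+1]. *)
pose t l := Num.truncn ((x (lift i l) 0 + S) / d).
have tP l : (t l)%:R * d <= x (lift i l) 0 + S < (t l)%:R * d + d.
  have := xM l; rewrite ltr_norml -/S => /andP[Sx xS].
  have : 0 <= (x (lift i l) 0 + S) / d by rewrite divr_ge0 ?(ltW d0)//; lra.
  move=> /truncn_itv; rewrite -/(t l) ler_pdivlMr// ltr_pdivrMr// -natr1.
  by rewrite mulrDl mul1r.
have tN l : (t l < N.+1)%N.
  have /andP[tx _] := tP l; have := xM l; rewrite ltr_norml -/S => /andP[_ xS].
  rewrite -(ltr_nat R) -(ltr_pM2r d0) [ltRHS]mulrC -dN; lra.
exists [ffun l => Ordinal (tN l)] => j; rewrite !mxE.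
case: unliftP => [l ->|->].
  by rewrite /corner ffunE /=; have := tP l; lra.
suff : `|x i 0 - height [ffun l => Ordinal (tN l)]| <= slope * d.
  by rewrite ler_distl.
rewrite xi /height opprK addrC -sumrB (le_trans (ler_norm_sum _ _ _))//.
rewrite mulr_suml ler_sum// => l _; rewrite -mulrBr normrM ler_wpM2l//.
rewrite /corner ffunE /= ler_norml; have := tP l; lra.
Qed.

(** The bound of [slice_le] tends to 0 as the grid is refined. *)
Let slice0 M : lebesgue_outer (slice M) = 0%E.
Proof.
apply/eqP; rewrite eq_le lebesgue_outer_ge0 andbT.
apply/lee_addgt0Pr => e e0; rewrite add0e.
set K := 2 * slope * (2 * M.+1%:R) ^+ q.+1.
have K0 : 0 <= K by rewrite !mulr_ge0// exprn_ge0// mulr_ge0.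
have Ke0 : 0 <= K / e by rewrite divr_ge0// ltW.
apply: le_trans (slice_le M (Num.bound (K / e))) _.
rewrite lee_fin ler_pdivrMr// [leRHS]mulrC -ler_pdivrMr// ltW//.
by rewrite (lt_le_trans (archi_boundP Ke0))// ler_nat.
Qed.

Lemma lebesgue_outer_hyperplane_succ :
  lebesgue_outer [set x | dot c x = 0] = 0%E.
Proof.
apply/eqP; rewrite eq_le lebesgue_outer_ge0 andbT.
rewrite -(lebesgue_outer_bigcup0 slice0); apply: le_lebesgue_outer => x /= cx.
pose s := \sum_j `|x j 0|; have s0 : 0 <= s by exact: sumr_ge0.
exists (Num.bound s) => //; split=> // l.
apply: (@le_lt_trans _ _ s); first by rewrite /s (bigD1 (lift i l))//= lerDl sumr_ge0.
by rewrite (lt_le_trans (archi_boundP s0))// ler_nat.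
Qed.

End Hyperplane.

Lemma lebesgue_outer_hyperplane (R : realType) p (c : 'cV[R]_p) : c != 0 ->
  lebesgue_outer [set x | dot c x = 0] = 0%E.
Proof.
case: p c => [|p] c c0; first by rewrite (flatmx0 c) eqxx in c0.
have /existsP[i] : [exists i, c i 0 != 0].
  apply: contraNT c0 => /existsPn c0; apply/eqP/colP => i; rewrite mxE.
  by apply/eqP; rewrite -[_ == _]negbK c0.
exact: lebesgue_outer_hyperplane_succ.
Qed.

Lemma lebesgue_outer_ambiguous (R : realType) (m p k : nat) (D : 'M[R]_(m, p)) :
  (k <= m)%N ->
  (forall i j : 'I_m, i != j -> row i D != row j D) ->
  (forall i j : 'I_m, i != j -> row i D != - row j D) ->
  lebesgue_outer [set x : 'cV[R]_p | ~ unambiguous k (D *m x)] = 0%E.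
Proof.
move=> km Dne DneN.
pose c (t : 'I_m * 'I_m * bool) : 'cV[R]_p :=
  (if t.2 then row t.1.1 D - row t.1.2 D else row t.1.1 D + row t.1.2 D)^T.
(* Requiring distinct indices inside the set makes the diagonal members empty, so [t] can range over
   the whole product type. *)
pose H (t : 'I_m * 'I_m * bool) : set 'cV[R]_p :=
  [set x | t.1.1 != t.1.2 /\ dot (c t) x = 0].
have H0 t : lebesgue_outer (H t) = 0%E.
  apply/eqP; rewrite eq_le lebesgue_outer_ge0 andbT.
  have [tt|tt] := eqVneq t.1.1 t.1.2.
    have -> : H t = set0 by rewrite -subset0 => x [/eqP].
    by rewrite lebesgue_outer0.
  rewrite -(@lebesgue_outer_hyperplane _ _ (c t)).
    by apply: le_lebesgue_outer => x [].
  rewrite -trmx0 (inj_eq trmx_inj); case: t tt => [[i j] []] /= ij.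
    by rewrite subr_eq0 Dne.
  by rewrite addr_eq0 DneN.
apply/eqP; rewrite eq_le lebesgue_outer_ge0 andbT.
rewrite -(lebesgue_outer_bigcup_count0 H0); apply: le_lebesgue_outer => x /= amb.
have Dx i : (D *m x) i 0 = dot (row i D)^T x.
  by rewrite mxE; apply: eq_bigr => j _; rewrite !mxE.
apply: contra_notP amb => noH; apply: distinct_unambiguous => // i j ij.
apply/negP; rewrite eqr_norm2 => /orP[] /eqP Dij; apply: noH.
- exists (i, j, true) => //; split=> //.
  by rewrite /c/= raddfB dotDl dotNl -!Dx Dij subrr.
- exists (i, j, false) => //; split=> //.
  by rewrite /c/= raddfD dotDl -!Dx Dij addNr.
Qed.

(* In the last part, the hypothesis [row i D != - row j D] cannot be dropped:
   if D has the two rows d and - d and k = 1, then D x is ambiguous for all x. *)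
Theorem proposition4p4 (R : realType) (m p k : nat) (D : 'M[R]_(m, p))
    (hk : (k <= m)%N) :
  (forall f : 'cV[R]_p -> R,
     semialgebraic_fun f -> strongly_convex f -> lipschitz_gradient f ->
     exists2 rho0 : R, 0 < rho0 &
       forall rho : R, rho0 <= rho ->
       forall (P : 'cV[R]_m -> 'cV[R]_m) (x : nat -> 'cV[R]_p),
         projection (sparse R m k) P ->
         proximal_distance_iterates D f rho P x ->
         exists xinf : 'cV[R]_p,
           x @ \oo --> xinf /\
           (unambiguous k (D *m xinf) ->
              stationary D (sparse R m k) f rho xinf /\
              linear_convergence x xinf))
  /\
  ((forall i j : 'I_m, i != j -> row i D != row j D) ->
   (forall i j : 'I_m, i != j -> row i D != - row j D) ->
   lebesgue_outer [set x : 'cV[R]_p | ~ unambiguous k (D *m x)] = 0%E).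
Proof.
split; last exact: lebesgue_outer_ambiguous.
(* The threshold 1 ensures [0 < rho], which is what the contraction estimate asks of [rho]. *)
move=> f _ [mu mu0 fmu] [df _]; exists 1 => // rho rho1 P x projP xP.
have rho0 : 0 < rho by exact: lt_le_trans rho1.
have [l xl] := iterates_cvg mu0 rho0 fmu projP xP.
exists l; split=> // -[J [Jk Jl]].
have PJ := unambiguous_eventually_keep projP xl Jk Jl.
have lmin := limit_argmin xP xl (differentiable_continuous (df l)) PJ.
split; last exact: (limit_linear_convergence mu0 rho0 fmu xP lmin PJ).
(* At an unambiguous limit the closest point is unique, so the equation has to be checked only for
   [keep J (D *m l)]. *)
move=> z /(unambiguous_closest Jk Jl) ->.
exact: (prox_stationary (df l) lmin).
Qed.
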